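(* Let $p$ be a prime with $p\equiv 3 \pmod 4$, and let $r$ be a positive integer. Let $A,B\subset(\mathbb{Z}/p^r\mathbb{Z})^2$ and put $\delta_A=|A|/p^{2r}$, $\delta_B=|B|/p^{2r}$. Suppose that $\delta_A^{1/2}\cdot\delta_B\ge 2p^{-1}$. Then for a positive proportion of $g\in SO_2(\mathbb{Z}/p^r\mathbb{Z})$ we have $|gA-B|\gg p^{2r}$; that is, there are absolute constants $c,c'>0$ (independent of $p,r,A,B$) such that \[\#\{g\in SO_2(\mathbb{Z}/p^r\mathbb{Z}) : |gA-B|\ge c\,p^{2r}\}\ge c'\,|SO_2(\mathbb{Z}/p^r\mathbb{Z})|.\]
   Context: $SO_2(\mathbb{Z}/p^r\mathbb{Z})$ is the group of matrices $\begin{bmatrix}a&-b\\ b&a\end{bmatrix}$ with $a,b\in\mathbb{Z}/p^r\mathbb{Z}$ and $a^2+b^2\equiv 1\pmod{p^r}$, acting on $(\mathbb{Z}/p^r\mathbb{Z})^2$ by matrix multiplication. For $g$ in this group, $gA-B=\{g\mathbf{a}-\mathbf{b}:\mathbf{a}\in A,\mathbf{b}\in B\}$. The notation $X\gg Y$ means $X\ge CY$ for an absolute constant $C>0$. *)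

(* Defs.v *)
From HB Require Import structures.
From mathcomp Require Import all_boot all_order all_algebra.
From mathcomp Require Import reals.
Set Implicit Arguments.
Unset Strict Implicit.
Unset Printing Implicit Defensive.
Import Order.TTheory GRing.Theory Num.Theory.
Local Open Scope ring_scope.

(* 'Z_n is Z/nZ only for n >= 2; all uses below are at n = p ^ r with p prime
   and r > 0. *)

Definition rot_mx (n : nat) (a b : 'Z_n) : 'M['Z_n]_2 :=
  \matrix_(i < 2, j < 2)
    if i == j then a else if i == 0 then - b else b.

Definition SO2 (n : nat) : {set 'M['Z_n]_2} :=
  [set g | [exists a : 'Z_n, exists b : 'Z_n,
              (g == rot_mx a b) && (a ^+ 2 + b ^+ 2 == 1)]].

Definition rot_diff (n : nat) (g : 'M['Z_n]_2) (A B : {set 'cV['Z_n]_2}) :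
  {set 'cV['Z_n]_2} := [set g *m a - b | a in A, b in B].

Definition density (R : realType) (p r : nat) (A : {set 'cV['Z_(p ^ r)]_2}) : R :=
  #|A|%:R / (p ^ (2 * r))%:R.

(* Main.v *)
Require Import Defs.
From HB Require Import structures.
From mathcomp Require Import all_boot all_order all_algebra.
From mathcomp Require Import reals.
From mathcomp Require Import algC cyclotomic finfield ring zify.
Set Implicit Arguments.
Unset Strict Implicit.
Unset Printing Implicit Defensive.
Import Order.TTheory GRing.Theory Num.Theory.
Local Open Scope ring_scope.

(* Write N = p^r, V = (Z/N)^2, G = SO_2(Z/N), and let rep_count g count the
   representations u = g a - b.  By Cauchy-Schwarz and Markov it is enough to
   bound the energy sum_g sum_u (rep_count g u)^2 by O(|G| |A|^2 |B|^2 / N^2).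
   By Plancherel N^2 times the energy is sum_u |B^(u)|^2 M(u), where
   M(u) = sum_(g in G) |A^(g u)|^2; the term u = 0 is the main term, and the
   density hypothesis reduces the others to M(u)^2 <= 9 |G|^2 |A|^3 N^2 / p^2.
   - If p u = 0, the orbit G u is a circle in a plane over F_p which is
     anisotropic as p = 3 mod 4, so apart from x + (-x) = 0 sums of two points
     of it are unique; this yields the L^(4/3) -> L^2 restriction estimate
     S^2 <= 3 N^2 |A|^3 for the sum S of |A^|^2 over the orbit, and the orbit
     has at least p points.
   - If p u <> 0, expand the square.  Pairs with a = a' mod p are few.  For the
     other pairs, averaging over rotations close to 1 kills the character sum
     over G except for the at most 2 |G| / p rotations g for which g u is
     orthogonal to a - a' modulo p. *)

(** Cauchy-Schwarz against the constant 1: each product in the expanded square is at most the mean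
    of the two squares. *)
Lemma sqr_norm_sum_le (I : finType) (P : pred I) (f : I -> algC) :
  `|\sum_(i | P i) f i| ^+ 2 <= #|P|%:R * \sum_(i | P i) `|f i| ^+ 2.
Proof.
apply: (@le_trans _ _ ((\sum_(i | P i) `|f i|) ^+ 2)).
  by rewrite lerXn2r ?nnegrE ?sumr_ge0 // ler_norm_sum.
rewrite expr2 mulr_suml.
apply: (@le_trans _ _ (\sum_(i | P i) \sum_(j | P j)
          2^-1 * (`|f i| ^+ 2 + `|f j| ^+ 2))).
  apply: ler_sum => i _; rewrite mulr_sumr; apply: ler_sum => j _.
  rewrite -(ler_pM2l (x := 2)) // mulVKf ?pnatr_eq0 // mulr_natl.
  by rewrite real_leif_mean_square_scaled ?normr_real.
under eq_bigr do rewrite -mulr_sumr big_split /= sumr_const.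
rewrite -mulr_sumr big_split /= sumr_const sumrMnl -mulr2n.
by rewrite -[X in _ * X <= _]mulr_natl mulKf ?pnatr_eq0 // mulr_natl.
Qed.

(** * Fourier analysis on a finite abelian group, self-dual through a symmetric bicharacter *)

Section Fourier.

Variables (V : finZmodType) (e : V -> V -> algC).
Hypothesis eDl : forall x y u, e (x + y) u = e x u * e y u.
Hypothesis eC : forall x u, e x u = e u x.
Hypothesis e_norm : forall x u, `|e x u| = 1.
Hypothesis e_nondeg : forall x, x != 0 -> exists u, e x u != 1.

Lemma bicharDr x u v : e x (u + v) = e x u * e x v.
Proof. by rewrite eC eDl ![e _ x]eC. Qed.

Lemma bichar_neq0 x u : e x u != 0.
Proof. by rewrite -normr_eq0 e_norm oner_eq0. Qed.

Lemma bichar0l u : e 0 u = 1.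
Proof. by apply: (mulfI (bichar_neq0 0 u)); rewrite -eDl addr0 mulr1. Qed.

Lemma conj_bichar x u : (e x u)^* = (e x u)^-1.
Proof.
by apply: (mulfI (bichar_neq0 x u)); rewrite divff ?bichar_neq0 // -normCK e_norm expr1n.
Qed.

Lemma bicharNl x u : e (- x) u = (e x u)^*.
Proof.
rewrite conj_bichar; apply: (mulfI (bichar_neq0 x u)).
by rewrite -eDl subrr bichar0l divff ?bichar_neq0.
Qed.

Lemma bicharNr x u : e x (- u) = (e x u)^*.
Proof. by rewrite eC bicharNl eC. Qed.

(** Orthogonality: for [x] nonzero, translating [u] by some [v] with [e x v != 1] multiplies the sum
    by [e x v]. *)
Lemma sum_bichar x : \sum_u e x u = if x == 0 then #|V|%:R else 0.
Proof.
have [->|nz_x] := eqVneq; first by under eq_bigr do rewrite bichar0l; rewrite sumr_const.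
have [v ev] := e_nondeg nz_x.
have: e x v - 1 != 0 by rewrite subr_eq0.
move/mulfI; apply; rewrite mulr0; apply/eqP; rewrite mulrBl mul1r mulr_sumr subr_eq0; apply/eqP.
rewrite [RHS](reindex_inj (addrI v)); by apply: eq_bigr => u _; rewrite bicharDr.
Qed.

Definition fourier (f : V -> algC) (u : V) : algC := \sum_x f x * e x u.

(** After expanding, orthogonality leaves only the diagonal; [fourier] is unnormalized, whence the
    factor [#|V|]. *)
Lemma plancherel (f : V -> algC) :
  \sum_u `|fourier f u| ^+ 2 = #|V|%:R * \sum_x `|f x| ^+ 2.
Proof.
transitivity (\sum_x \sum_y f x * (f y)^* * \sum_u e (x - y) u).
  under eq_bigr do rewrite normCK rmorph_sum mulr_suml.
  rewrite exchange_big /=; apply: eq_bigr => x _.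
  under eq_bigr do rewrite mulr_sumr.
  rewrite exchange_big /=; apply: eq_bigr => y _.
  rewrite mulr_sumr; apply: eq_bigr => u _.
  by rewrite eDl bicharNl rmorphM /= mulrACA.
rewrite mulr_sumr; apply: eq_bigr => x _.
rewrite (bigD1 x) //= subrr sum_bichar eqxx big1 ?addr0; first by rewrite -normCK mulrC.
by move=> y ne_yx; rewrite sum_bichar subr_eq0 eq_sym (negPf ne_yx) mulr0.
Qed.

(** * Restriction estimate for a set whose nonzero sums of two points are unique *)

Section SidonRestriction.

Variables A C : {set V}.
Hypothesis sidonC : forall x y u v, x \in C -> y \in C -> u \in C -> v \in C ->
  x + y = u + v -> x + y != 0 -> (u = x /\ v = y) \/ (u = y /\ v = x).

Let Ahat w := \sum_(a in A) e a w.
Let S := \sum_(w in C) `|Ahat w| ^+ 2.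
(** The extension operator, adjoint to restriction to [C], applied to the conjugate of [Ahat]. *)
Let h x := \sum_(w in C) (Ahat w)^* * e w x.
Let pairs z := [pred q : V * V | (q.1 \in C) && (q.2 \in C) && (q.1 + q.2 == z)].
(** Additive self-convolution of the conjugate of [Ahat] cut off to [C]. *)
Let H z := \sum_(q | pairs z q) (Ahat q.1)^* * (Ahat q.2)^*.

Lemma sum_transform_ge0 : 0 <= S.
Proof. by apply: sumr_ge0 => w _; rewrite exprn_ge0. Qed.

Lemma transformN w : Ahat (- w) = (Ahat w)^*.
Proof. by rewrite rmorph_sum; apply: eq_bigr => a _; rewrite bicharNr. Qed.

Lemma sum_extension : \sum_(a in A) h a = S.
Proof.
rewrite exchange_big /=; apply: eq_bigr => w _.
by rewrite -mulr_sumr mulrC normCK; congr (_ * _); apply: eq_bigr => a _; rewrite eC.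
Qed.

Lemma sum_pairs (f : V * V -> algC) :
  \sum_z \sum_(q | pairs z q) f q = \sum_(x in C) \sum_(y in C) f (x, y).
Proof.
rewrite pair_big /= [RHS](partition_big (fun q => q.1 + q.2) predT) //=.
by apply: eq_bigr => z _; apply: eq_bigr => -[].
Qed.

Lemma extension_sqr x : h x ^+ 2 = fourier H x.
Proof.
rewrite /fourier; under eq_bigr do rewrite mulr_suml.
rewrite (eq_bigr (fun z => \sum_(q | pairs z q)
    ((Ahat q.1)^* * e q.1 x) * ((Ahat q.2)^* * e q.2 x))); last first.
  move=> z _; apply: eq_bigr => q /andP[_ /eqP <-].
  by rewrite eDl mulrACA.
rewrite (sum_pairs (fun q => ((Ahat q.1)^* * e q.1 x) * ((Ahat q.2)^* * e q.2 x))) /=.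
by rewrite expr2 mulr_suml; apply: eq_bigr => w _; rewrite mulr_sumr.
Qed.

(** A pair of sum 0 is some [(w, - w)], and [Ahat (- w)] is the conjugate of [Ahat w], so each [w]
    contributes at most its own term of [S]. *)
Lemma convolution0_le : `|H 0| <= S.
Proof.
rewrite (le_trans (ler_norm_sum _ _ _)) //.
rewrite (eq_bigr (fun q => `|Ahat q.1| ^+ 2)); last first.
  move=> q /andP[_]; rewrite addr_eq0 => /eqP q12.
  by rewrite normrM q12 transformN conjCK !norm_conjC expr2.
rewrite /S (partition_big (fun q : V * V => q.1) (mem C)) /=; last by move=> q /andP[/andP[]].
apply: ler_sum => w wC.
rewrite (eq_bigl (fun q => (q == (w, - w)) && (- w \in C))); last first.
  case=> x y /=; rewrite xpair_eqE.
  have [->|] := eqVneq x w; last by rewrite !andbF.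
  rewrite addrC addr_eq0 wC /= andbT.
  by have [->|] := eqVneq y (- w); rewrite ?andbF ?andbT.
case: (- w \in C); last by under eq_bigl do rewrite andbF; rewrite big_pred0_eq exprn_ge0.
by under eq_bigl do rewrite andbT; rewrite big_pred1_eq.
Qed.

Lemma card_pairs_le z : z != 0 -> (#|pairs z| <= 2)%N.
Proof.
move=> nz_z; have [q qz|/eq_card0->//] := pickP (pairs z).
have sub : {subset pairs z <= [set q; (q.2, q.1)] : {set V * V}}.
  move: qz; case: q => x y /= /andP[/andP[xC yC] /eqP xy] [u v] /andP[/andP[/= uC vC] /eqP uv].
  rewrite !inE !xpair_eqE.
  by case: (@sidonC x y u v) => //; rewrite ?xy // => -[-> ->]; rewrite !eqxx ?orbT.
by rewrite (leq_trans (subset_leq_card (introT subsetP sub))) // cards2; case: eqP.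
Qed.

(** The constant is 1 + 2: [z = 0] gives at most [S ^+ 2]; elsewhere Cauchy-Schwarz over at most two
    pairs costs a factor 2, and the products over all pairs sum to [S ^+ 2]. *)
Lemma convolution_l2_le : \sum_z `|H z| ^+ 2 <= 3 * S ^+ 2.
Proof.
have S0 := sum_transform_ge0.
have -> : 3 * S ^+ 2 = S ^+ 2 + 2 * S ^+ 2 by ring.
rewrite (bigD1 0) //= lerD //; first by rewrite lerXn2r ?nnegrE ?convolution0_le.
have -> : S ^+ 2 = \sum_z \sum_(q | pairs z q) (`|Ahat q.1| ^+ 2 * `|Ahat q.2| ^+ 2).
  rewrite (sum_pairs (fun q => `|Ahat q.1| ^+ 2 * `|Ahat q.2| ^+ 2)) /=.
  by rewrite expr2 mulr_suml; apply: eq_bigr => w _; rewrite mulr_sumr.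
have ge0 z : 0 <= \sum_(q | pairs z q) (`|Ahat q.1| ^+ 2 * `|Ahat q.2| ^+ 2).
  by apply: sumr_ge0 => q _; rewrite mulr_ge0 ?exprn_ge0.
rewrite [X in _ <= _ * X](bigD1 0) //= mulrDr -[X in X <= _]add0r lerD ?mulr_ge0 ?ge0 //.
rewrite mulr_sumr; apply: ler_sum => z nz_z.
apply: (le_trans (sqr_norm_sum_le _ _)).
rewrite (eq_bigr (fun q => `|Ahat q.1| ^+ 2 * `|Ahat q.2| ^+ 2)); last first.
  by move=> q _; rewrite normrM !norm_conjC exprMn.
by rewrite ler_wpM2r // ler_nat card_pairs_le.
Qed.

(** Duality and two uses of Cauchy-Schwarz bound [S ^+ 4] by [|A|^3] times the fourth moment of [h].
    As [h ^+ 2] is the transform of [H], Plancherel bounds that moment by [3 * |V| * S ^+ 2]; then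
    [S ^+ 2] cancels. *)
Lemma sidon_restriction : S ^+ 2 <= (3 * #|V| * #|A| ^ 3)%:R.
Proof.
have S0 := sum_transform_ge0.
have [->|nzS] := eqVneq S 0; first by rewrite expr0n.
have Sgt0 : 0 < S ^+ 2 by rewrite exprn_gt0 // lt_def nzS.
rewrite -(ler_pM2r Sgt0) -expr2.
pose T := \sum_(a in A) `|h a| ^+ 2.
have T0 : 0 <= T by apply: sumr_ge0 => a _; rewrite exprn_ge0.
have le1 : S ^+ 2 <= #|A|%:R * T.
  by rewrite -sum_extension -[X in X ^+ 2]ger0_norm ?sum_extension // -sum_extension sqr_norm_sum_le.
have le2 : T ^+ 2 <= #|A|%:R * \sum_x `|h x| ^+ 4.
  rewrite -[T]ger0_norm // (le_trans (sqr_norm_sum_le _ _)) // ler_wpM2l //.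
  under eq_bigr do rewrite ger0_norm ?exprn_ge0 // -exprM.
  (* Positivity extends the sum from [A] to the whole group, where Plancherel applies. *)
  by rewrite [leRHS](bigID (mem A)) /= lerDl sumr_ge0 // => x _; rewrite exprn_ge0.
have eq3 : \sum_x `|h x| ^+ 4 = #|V|%:R * \sum_z `|H z| ^+ 2.
  rewrite -plancherel; apply: eq_bigr => x _.
  by rewrite -extension_sqr normrX -exprM.
have le4 : (S ^+ 2) ^+ 2 <= #|A|%:R ^+ 2 * T ^+ 2.
  by rewrite -exprMn lerXn2r ?nnegrE ?mulr_ge0 // ltW.
apply: (le_trans le4); rewrite 2!natrM natrX.
have -> : 3%:R * #|V|%:R * #|A|%:R ^+ 3 * S ^+ 2 =
          #|A|%:R ^+ 2 * (#|A|%:R * (#|V|%:R * (3 * S ^+ 2))) by ring.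
rewrite ler_wpM2l ?exprn_ge0 // (le_trans le2) // eq3.
by rewrite !ler_wpM2l // convolution_l2_le.
Qed.

End SidonRestriction.

End Fourier.

(** * Anisotropic planes and sums of two points of a circle *)

Definition anisotropic (F : fieldType) :=
  forall x y : F, x ^+ 2 + y ^+ 2 = 0 -> x = 0 /\ y = 0.

Lemma Fp_anisotropic (p : nat) : prime p -> (p = 3 %[mod 4])%N -> anisotropic 'F_p.
Proof.
move=> p_pr p34 x y xy0.
(* This shape shows [(p - 1) / 2] to be odd: a square root [z] of -1 would satisfy
   [z ^+ (p - 1) = -1], against Fermat as [p] does not divide 2. *)
have p4 : (p = (p %/ 4).*2.+1.*2.+1)%N by rewrite {1}(divn_eq p 4) p34; lia.
have y0 : y = 0.
  apply/eqP; apply: contraT => nz_y.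
  have z2 : (x / y) ^+ 2 = -1.
    by apply/eqP; rewrite expr_div_n -subr_eq0 opprK -(divff (expf_neq0 2 nz_y)) -mulrDl xy0 mul0r.
  have nz_z : x / y != 0 by rewrite -sqrf_eq0 z2 oppr_eq0 oner_eq0.
  have := expf_card (x / y); rewrite card_Fp // [X in _ ^+ X]p4 exprS -[X in _ = X -> _]mulr1 => /(mulfI nz_z).
  rewrite -mul2n exprM z2 exprS -mul2n exprM sqrrN !expr1n mulr1 => /eqP.
  rewrite eq_sym -subr_eq0 opprK -[1 + 1]/(2%:R : 'F_p) -(dvdn_pcharf (pchar_Fp p_pr)).
  by move/dvdn_leq => /(_ isT); lia.
by split=> //; apply/eqP; rewrite -sqrf_eq0 -xy0 y0 expr0n addr0.
Qed.

(* For gi = (ai, bi), (u, v) = g1 - g3 and (s, q) = g3 - g2, the unit norms make g1 + g2,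
   (u, v) and (s, q) pairwise orthogonal; in an anisotropic plane one of them
   vanishes. *)
Lemma circle_sidon (F : fieldType) (a1 b1 a2 b2 a3 b3 a4 b4 : F) :
  anisotropic F -> (2 : F) != 0 ->
  a1 ^+ 2 + b1 ^+ 2 = 1 -> a2 ^+ 2 + b2 ^+ 2 = 1 ->
  a3 ^+ 2 + b3 ^+ 2 = 1 -> a4 ^+ 2 + b4 ^+ 2 = 1 ->
  a1 + a2 = a3 + a4 -> b1 + b2 = b3 + b4 ->
  [\/ a1 + a2 = 0 /\ b1 + b2 = 0,
      a3 = a1 /\ b3 = b1 | a3 = a2 /\ b3 = b2].
Proof.
move=> aniso nz2 n1 n2 n3 n4 eqa eqb.
pose u := a1 - a3; pose v := b1 - b3; pose s := a3 - a2; pose q := b3 - b2.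
have us : u * s + v * q = 0.
  apply: (mulfI nz2); rewrite mulr0.
  have -> : 0 = (a1 ^+ 2 + b1 ^+ 2) - (a3 ^+ 2 + b3 ^+ 2)
     - (a4 ^+ 2 + b4 ^+ 2) + (a2 ^+ 2 + b2 ^+ 2) by rewrite n1 n2 n3 n4; ring.
  have -> : a4 = a1 + a2 - a3 by rewrite eqa; ring.
  have -> : b4 = b1 + b2 - b3 by rewrite eqb; ring.
  by rewrite /u /v /s /q; ring.
have zs : (a1 + a2) * s + (b1 + b2) * q = 0.
  have -> : (a1 + a2) * s + (b1 + b2) * q =
     u * s + v * q + (a3 ^+ 2 + b3 ^+ 2) - (a2 ^+ 2 + b2 ^+ 2) by rewrite /u /v /s /q; ring.
  by rewrite us n2 n3; ring.
have zu : (a1 + a2) * u + (b1 + b2) * v = 0.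
  have -> : (a1 + a2) * u + (b1 + b2) * v =
     (a1 ^+ 2 + b1 ^+ 2) - (a3 ^+ 2 + b3 ^+ 2) - (u * s + v * q) by rewrite /u /v /s /q; ring.
  by rewrite us n1 n3; ring.
(* If the determinant is nonzero, [(u, v)] and [(s, q)] span the plane, so g1 + g2 vanishes; if it
   is 0, Lagrange's identity makes the product of their norms vanish. *)
have [det0|nz_det] := eqVneq (u * q - v * s) 0; last first.
  apply: Or31; split; apply: (mulfI nz_det).
    have -> : (u * q - v * s) * (a1 + a2) =
      q * ((a1 + a2) * u + (b1 + b2) * v) - v * ((a1 + a2) * s + (b1 + b2) * q) by ring.
    by rewrite zs zu; ring.
  have -> : (u * q - v * s) * (b1 + b2) =
      u * ((a1 + a2) * s + (b1 + b2) * q) - s * ((a1 + a2) * u + (b1 + b2) * v) by ring.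
  by rewrite zs zu; ring.
have /eqP : (u ^+ 2 + v ^+ 2) * (s ^+ 2 + q ^+ 2) = 0.
  have -> : (u ^+ 2 + v ^+ 2) * (s ^+ 2 + q ^+ 2) =
    (u * q - v * s) ^+ 2 + (u * s + v * q) ^+ 2 by ring.
  by rewrite us det0; ring.
rewrite mulf_eq0 => /orP[] /eqP /aniso[/eqP]; rewrite subr_eq0 => /eqP e1 /eqP;
  rewrite subr_eq0 => /eqP e2.
- by apply: Or32.
- by apply: Or33.
Qed.

Lemma ord2_ind (P : 'I_2 -> Prop) : P 0 -> P 1 -> forall i, P i.
Proof.
move=> P0 P1 [[|[|//]] lti]; first by rewrite (_ : Ordinal lti = 0) //; apply: val_inj.
by rewrite (_ : Ordinal lti = 1) //; apply: val_inj.
Qed.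

(** * Algebra of rotations and the dot product *)

Section Rotations.

Variable n : nat.
Implicit Types (a b c d : 'Z_n) (g : 'M['Z_n]_2) (x y : 'cV['Z_n]_2).

Lemma cV2_eq x y : x 0 0 = y 0 0 -> x 1 0 = y 1 0 -> x = y.
Proof. by move=> e0 e1; apply/colP; apply: ord2_ind. Qed.

Lemma cV2_eq0 x : (x == 0) = (x 0 0 == 0) && (x 1 0 == 0).
Proof.
apply/eqP/andP => [->|[/eqP x0 /eqP x1]]; first by rewrite !mxE.
by apply: cV2_eq; rewrite !mxE.
Qed.

Lemma rot_mul0 a b x : (rot_mx a b *m x) 0 0 = a * x 0 0 - b * x 1 0.
Proof. by rewrite mxE !big_ord_recl big_ord0 !mxE /= addr0 mulNr; congr (_ - _ * x _ _); apply: val_inj. Qed.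

Lemma rot_mul1 a b x : (rot_mx a b *m x) 1 0 = b * x 0 0 + a * x 1 0.
Proof. by rewrite mxE !big_ord_recl big_ord0 !mxE /= addr0; congr (_ + _ * x _ _); apply: val_inj. Qed.

Lemma rot_mx_mul a b c d :
  rot_mx a b *m rot_mx c d = rot_mx (a * c - b * d) (b * c + a * d).
Proof.
apply/matrixP => i j; rewrite mxE !big_ord_recl big_ord0 !mxE addr0 /=.
by move: i j; do 2!apply: ord2_ind => /=; ring.
Qed.

Lemma rot_mxD a b c d : rot_mx a b + rot_mx c d = rot_mx (a + c) (b + d).
Proof.
apply/matrixP => i j; rewrite !mxE.
by move: i j; do 2!apply: ord2_ind => /=; ring.
Qed.

Lemma rot_mxN a b : - rot_mx a b = rot_mx (- a) (- b).
Proof.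
apply/matrixP => i j; rewrite !mxE.
by move: i j; do 2!apply: ord2_ind.
Qed.

Lemma tr_rot_mx a b : (rot_mx a b)^T = rot_mx a (- b).
Proof.
apply/matrixP => i j; rewrite !mxE.
by move: i j; do 2!apply: ord2_ind => /=; rewrite ?opprK.
Qed.

Lemma rot_mx10 : rot_mx 1 0 = 1%:M :> 'M['Z_n]_2.
Proof.
apply/matrixP => i j; rewrite !mxE.
by move: i j; do 2!apply: ord2_ind => /=; rewrite ?oppr0.
Qed.

Lemma SO2P g :
  reflect (exists a b, g = rot_mx a b /\ a ^+ 2 + b ^+ 2 = 1) (g \in SO2 n).
Proof.
rewrite inE; apply: (iffP existsP) => [[a /existsP[b /andP[/eqP -> /eqP ab]]]|[a [b [-> ab]]]].
  by exists a, b.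
by exists a; apply/existsP; exists b; rewrite eqxx ab /=.
Qed.

Lemma SO2_mul g h : g \in SO2 n -> h \in SO2 n -> g *m h \in SO2 n.
Proof.
move=> /SO2P[a [b [-> ab]]] /SO2P[c [d [-> cd]]]; apply/SO2P.
exists (a * c - b * d), (b * c + a * d); rewrite rot_mx_mul; split=> //.
have -> : (a * c - b * d) ^+ 2 + (b * c + a * d) ^+ 2 =
  (a ^+ 2 + b ^+ 2) * (c ^+ 2 + d ^+ 2) by ring.
by rewrite ab cd mulr1.
Qed.

Lemma SO2_tr g : (g^T \in SO2 n) = (g \in SO2 n).
Proof.
suff sub h : h \in SO2 n -> h^T \in SO2 n.
  by apply/idP/idP => /sub; rewrite ?trmxK.
by move=> /SO2P[a [b [-> ab]]]; apply/SO2P; exists a, (- b); rewrite tr_rot_mx sqrrN.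
Qed.

Lemma SO2_trK g : g \in SO2 n -> g^T *m g = 1%:M.
Proof.
move=> /SO2P[a [b [-> ab]]]; rewrite tr_rot_mx rot_mx_mul -rot_mx10.
by congr rot_mx; [rewrite -ab|]; ring.
Qed.

Lemma SO2_mulK g : g \in SO2 n -> g *m g^T = 1%:M.
Proof. by rewrite -SO2_tr => /SO2_trK; rewrite trmxK. Qed.

(** Transposition is inversion in the rotation group, hence permutes it. *)
Lemma sum_SO2_tr (f : 'M['Z_n]_2 -> algC) :
  \sum_(g in SO2 n) f g^T = \sum_(g in SO2 n) f g.
Proof.
rewrite [RHS](reindex_inj (@trmx_inj _ _ _)) /=.
by apply: eq_bigl => g; rewrite SO2_tr.
Qed.

Lemma sum_SO2_mulr k (f : 'M['Z_n]_2 -> algC) : k \in SO2 n ->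
  \sum_(g in SO2 n) f (g *m k) = \sum_(g in SO2 n) f g.
Proof.
move=> kG; rewrite [RHS](reindex (fun g => g *m k)) /=.
  apply: eq_bigl => g; apply/idP/idP => [gG|gkG]; first exact: SO2_mul.
  by rewrite -[g]mulmx1 -(SO2_mulK kG) mulmxA SO2_mul ?SO2_tr.
exists (fun g => g *m k^T) => g _; first by rewrite -mulmxA SO2_mulK ?mulmx1.
by rewrite -mulmxA SO2_trK ?mulmx1.
Qed.

Definition dot x y : 'Z_n := (x^T *m y) 0 0.

Lemma dotE x y : dot x y = x 0 0 * y 0 0 + x 1 0 * y 1 0.
Proof.
rewrite /dot mxE !big_ord_recl big_ord0 !mxE addr0.
by congr (_ + x _ _ * y _ _); apply: val_inj.
Qed.

Lemma dotC x y : dot x y = dot y x.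
Proof. by rewrite !dotE; ring. Qed.

Lemma dotDl x y z : dot (x + y) z = dot x z + dot y z.
Proof. by rewrite !dotE !mxE; ring. Qed.

Lemma dot_adj g x y : dot (g *m x) y = dot x (g^T *m y).
Proof. by rewrite /dot trmx_mul mulmxA. Qed.

End Rotations.

(** * Reduction modulo [p], torsion vectors and counting rotations *)

Section PrimePower.

Variables p r : nat.
Hypotheses (p_pr : prime p) (p34 : (p = 3 %[mod 4])%N) (r_gt0 : (0 < r)%N).
Local Notation N := (p ^ r)%N.
Local Notation V := 'cV['Z_N]_2.
Implicit Types (x y z a b t : 'Z_N) (u v w d xi : V) (g h : 'M['Z_N]_2).

Lemma modulus_gt1 : (1 < N)%N.
Proof. by rewrite -(exp1n r) ltn_exp2r // prime_gt1. Qed.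

Lemma card_plane : #|{: V}| = (p ^ (2 * r))%N.
Proof. by rewrite card_mx card_ord Zp_cast ?modulus_gt1 // muln1 mulnC expnM. Qed.

Definition red x : 'F_p := (x : nat)%:R.

(** Reduction modulo [N] changes [m] by a multiple of [p ^ r], which is 0 in ['F_p] as [r > 0]; the
    morphism laws of [red] rest on this. *)
Lemma red_nat m : red m%:R = m%:R.
Proof.
rewrite /red val_Zp_nat ?modulus_gt1 // [in RHS](divn_eq m N) natrD natrM.
by rewrite natrX pchar_Fp_0 // expr0n gtn_eqF // mulr0 add0r.
Qed.

Lemma redD : {morph red : x y / x + y}.
Proof. by move=> x y; rewrite -[x]natr_Zp -[y]natr_Zp -natrD !red_nat natrD. Qed.

Lemma redM : {morph red : x y / x * y}.
Proof. by move=> x y; rewrite -[x]natr_Zp -[y]natr_Zp -natrM !red_nat natrM. Qed.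

Lemma red0 : red 0 = 0. Proof. exact: (red_nat 0). Qed.
Lemma red1 : red 1 = 1. Proof. exact: (red_nat 1). Qed.

Lemma redN : {morph red : x / - x}.
Proof. by move=> x; apply/eqP; rewrite -addr_eq0 -redD addNr red0. Qed.

Lemma redB : {morph red : x y / x - y}.
Proof. by move=> x y; rewrite redD redN. Qed.

Lemma red_sqr x : red (x ^+ 2) = red x ^+ 2.
Proof. by rewrite !expr2 redM. Qed.

Lemma red_lift (s : 'F_p) : red (s : nat)%:R = s.
Proof. by rewrite red_nat natr_Zp. Qed.

Lemma red_unit x : red x != 0 -> x \is a GRing.unit.
Proof.
rewrite -[x]natr_Zp red_nat -(dvdn_pcharf (pchar_Fp p_pr)) => ndvd.
by rewrite unitZpE ?modulus_gt1 // coprime_pexpl // prime_coprime.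
Qed.

Lemma red_eq0_div x : red x = 0 -> exists y, x = y * p%:R.
Proof.
move/eqP; rewrite -[x]natr_Zp red_nat -(dvdn_pcharf (pchar_Fp p_pr)) => /dvdnP[q ->].
by exists q%:R; rewrite natrM.
Qed.

Lemma two_neq0 : (2 : 'F_p) != 0.
Proof.
rewrite -(dvdn_pcharf (pchar_Fp p_pr)); apply/negP => /dvdn_leq => /(_ isT) le_p2.
by have := prime_gt1 p_pr; have := divn_eq p 4; rewrite p34; lia.
Qed.

Lemma red_two : red 2 = 2.
Proof. exact: red_nat. Qed.

Let aniso : anisotropic 'F_p := Fp_anisotropic p_pr p34.

(** Scalars act on the kernel of [p] through [red], so it is a plane over ['F_p]. *)
Definition torsion u := p%:R *: u == 0.

Lemma torsion_mul g u : torsion u -> torsion (g *m u).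
Proof. by move=> /eqP u0; rewrite /torsion scalemxAr u0 mulmx0. Qed.

Lemma torsion_scale0 x u : torsion u -> red x = 0 -> x *: u = 0.
Proof. by move=> /eqP u0 /red_eq0_div[y ->]; rewrite -scalerA u0 scaler0. Qed.

Lemma scale_eq0_red x u : u != 0 -> x *: u = 0 -> red x = 0.
Proof.
move=> nz_u xu0; apply/eqP; apply: contraT => /red_unit ux.
by rewrite -[u]scale1r -(mulVr ux) -scalerA xu0 scaler0 eqxx in nz_u.
Qed.

Lemma rot_mulB a b x y u :
  rot_mx a b *m u - rot_mx x y *m u = rot_mx (a - x) (b - y) *m u.
Proof. by rewrite -mulmxBl rot_mxN rot_mxD. Qed.

(** The transpose of the difference matrix times the matrix is the scalar given by its norm. This
    norm kills [u], so it is 0 modulo [p], and anisotropy applies. *)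
Lemma rot_red_inj a b x y u : u != 0 ->
  rot_mx a b *m u = rot_mx x y *m u -> red a = red x /\ red b = red y.
Proof.
move=> nz_u /eqP; rewrite -subr_eq0 rot_mulB => /eqP eq0.
have norm0 : ((a - x) ^+ 2 + (b - y) ^+ 2) *: u = 0.
  have e0 := congr1 (fun m : V => m 0 0) eq0; have e1 := congr1 (fun m : V => m 1 0) eq0.
  rewrite /= rot_mul0 mxE in e0; rewrite /= rot_mul1 mxE in e1.
  apply: cV2_eq; rewrite !mxE.
    transitivity ((a - x) * ((a - x) * u 0 0 - (b - y) * u 1 0)
                + (b - y) * ((b - y) * u 0 0 + (a - x) * u 1 0)); first by ring.
    by rewrite e0 e1; ring.
  transitivity ((a - x) * ((b - y) * u 0 0 + (a - x) * u 1 0)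
              - (b - y) * ((a - x) * u 0 0 - (b - y) * u 1 0)); first by ring.
  by rewrite e0 e1; ring.
have := scale_eq0_red nz_u norm0; rewrite redD !red_sqr => /aniso[/eqP + /eqP].
by rewrite !redB !subr_eq0 => /eqP-> /eqP->.
Qed.

Lemma rot_torsion_eq a b x y u : torsion u ->
  red a = red x -> red b = red y -> rot_mx a b *m u = rot_mx x y *m u.
Proof.
move=> tu ax bY; apply/eqP; rewrite -subr_eq0 rot_mulB; apply/eqP.
have a0 := @torsion_scale0 (a - x) u tu; have b0 := @torsion_scale0 (b - y) u tu.
rewrite redB ax subrr in a0; rewrite redB bY subrr in b0.
have Ea i : (a - x) * u i 0 = 0 by have := congr1 (fun m : V => m i 0) (a0 erefl); rewrite !mxE.
have Eb i : (b - y) * u i 0 = 0 by have := congr1 (fun m : V => m i 0) (b0 erefl); rewrite !mxE.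
by apply: cV2_eq; rewrite ?rot_mul0 ?rot_mul1 !Ea !Eb mxE; ring.
Qed.

(* Rational parametrization of the circle; 1 + t^2 is a unit as -1 is not a
   square modulo p. *)
Definition cayley t := rot_mx ((1 - t ^+ 2) / (1 + t ^+ 2)) (2 * t / (1 + t ^+ 2)).

Lemma cayley_den_unit t : 1 + t ^+ 2 \is a GRing.unit.
Proof.
apply: red_unit; apply/eqP; rewrite redD -[X in red X + _](expr1n _ 2) !red_sqr => /aniso[/eqP].
by rewrite red1 oner_eq0.
Qed.

Lemma cayley_SO2 t : cayley t \in SO2 N.
Proof.
apply/SO2P; do 2!eexists; split; first by [].
have ut := cayley_den_unit t.
transitivity (((1 + t ^+ 2) / (1 + t ^+ 2)) ^+ 2); first by ring.
by rewrite divrr // expr1n.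
Qed.

(** The parameter is the slope [b / (a + 1)] of the rotation, where [a + 1 = 2 / (1 + t ^+ 2)] is
    nonzero modulo [p]. *)
Lemma cayley_red_inj t t' u : u != 0 ->
  cayley t *m u = cayley t' *m u -> red t = red t'.
Proof.
move=> nz_u /(rot_red_inj nz_u)[ea eb].
have den (s : 'Z_N) : (1 - s ^+ 2) / (1 + s ^+ 2) + 1 = 2 / (1 + s ^+ 2).
  by rewrite -[X in _ + X](divrr (cayley_den_unit s)) -mulrDl; congr (_ / _); ring.
have num (s : 'Z_N) : 2 * s / (1 + s ^+ 2) = s * ((1 - s ^+ 2) / (1 + s ^+ 2) + 1).
  by rewrite den; ring.
move: eb; rewrite !num !redM [red (_ + 1)]redD ea -redD.
suff nz : red ((1 - t' ^+ 2) / (1 + t' ^+ 2) + 1) != 0 by move/(mulIf nz).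
rewrite den redM mulf_neq0 ?red_two ?two_neq0 //; apply/eqP => V0.
have := red1; rewrite -(divrr (cayley_den_unit t')) redM V0 mulr0.
by move/eqP; rewrite eq_sym oner_eq0.
Qed.

(** The products of the fibre with the rotations [cayley s], for [s] in ['F_p], are disjoint: they
    send [u] to the [p] distinct vectors [cayley s *m v]. *)
Lemma card_transporter u v : u != 0 ->
  (p * #|[set g in SO2 N | g *m u == v]| <= #|SO2 N|)%N.
Proof.
move=> nz_u; set F := [set g in _ | _].
have [g0 g0F|F0] := pickP (mem F); last by rewrite eq_card0 ?muln0.
have nz_v : v != 0.
  move: g0F; rewrite /= inE => /andP[g0G /eqP <-]; apply: contraNneq nz_u => gu0.
  by rewrite -[u]mul1mx -(SO2_trK g0G) -mulmxA gu0 mulmx0.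
rewrite -{1}(card_Fp p_pr) -cardsT -cardsX.
pose f (q : 'F_p * 'M['Z_N]_2) := cayley (q.1 : nat)%:R *m q.2.
rewrite -(card_in_imset (f := f)); last first.
  move=> [s g] [s' g'] /setXP[_ /=]; rewrite inE => /andP[_ /eqP gu].
  move=> /setXP[_ /=]; rewrite inE => /andP[_ /eqP gu']; rewrite /f /= => eqf.
  have eqs : s = s'.
    rewrite -(red_lift s) -(red_lift s'); apply: (cayley_red_inj nz_v).
    by rewrite -{1}gu -gu' !mulmxA eqf.
  congr pair => //; move: eqf; rewrite eqs.
  move/(congr1 (mulmx (cayley s'%:R)^T)).
  by rewrite !mulmxA SO2_trK ?cayley_SO2 // !mul1mx.
apply: subset_leq_card; apply/subsetP => _ /imsetP[[s g] /setXP[_ /=] + ->].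
by rewrite inE => /andP[gG _]; rewrite SO2_mul ?cayley_SO2.
Qed.

(** By [rot_red_inj] the equation descends to the circle over ['F_p], where [circle_sidon] applies;
    [rot_torsion_eq] lifts its conclusion back. *)
Lemma orbit_sidon u : u != 0 -> torsion u ->
  let C := [set g *m u | g in SO2 N] in
  forall x y z t : V, x \in C -> y \in C -> z \in C -> t \in C ->
  x + y = z + t -> x + y != 0 -> (z = x /\ t = y) \/ (z = y /\ t = x).
Proof.
move=> nz_u tu C x y z t.
move=> /imsetP[_ /SO2P[a1 [b1 [-> n1]]] ->] /imsetP[_ /SO2P[a2 [b2 [-> n2]]] ->].
move=> /imsetP[_ /SO2P[a3 [b3 [-> n3]]] ->] /imsetP[_ /SO2P[a4 [b4 [-> n4]]] ->].
have normE a b : a ^+ 2 + b ^+ 2 = 1 -> red a ^+ 2 + red b ^+ 2 = 1.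
  by move=> n; rewrite -!red_sqr -redD n red1.
rewrite -!mulmxDl !rot_mxD => eqs nz_s; have [ea eb] := rot_red_inj nz_u eqs.
rewrite !redD in ea eb.
have := circle_sidon aniso two_neq0 (normE _ _ n1) (normE _ _ n2) (normE _ _ n3)
  (normE _ _ n4) ea eb.
case=> -[ea' eb'].
- case/eqP: nz_s; rewrite (@rot_torsion_eq _ _ 0 0) ?redD ?ea' ?eb' ?red0 //.
  by apply: cV2_eq; rewrite ?rot_mul0 ?rot_mul1 mxE; ring.
- left; split; apply: rot_torsion_eq => //.
  + by apply: (addrI (red a3)); rewrite -ea ea'.
  + by apply: (addrI (red b3)); rewrite -eb eb'.
- right; split; apply: rot_torsion_eq => //.
  + by apply: (addrI (red a3)); rewrite -ea ea' addrC.
  + by apply: (addrI (red b3)); rewrite -eb eb' addrC.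
Qed.

Definition div_p : {set V} := [set d : V | (red (d 0 0) == 0) && (red (d 1 0) == 0)].

(** The [p ^ 2] translates of [div_p] by lifts of the vectors over ['F_p] are disjoint. *)
Lemma card_div_p : (p ^ 2 * #|div_p| <= p ^ (2 * r))%N.
Proof.
rewrite -card_plane -{1}(card_Fp p_pr) -[(_ ^ 2)%N](card_mx 'F_p 2 1) -cardsT -cardsX.
pose f (q : 'cV['F_p]_2 * V) := map_mx (fun s : 'F_p => (s : nat)%:R) q.1 + q.2.
rewrite -(card_in_imset (f := f)) ?max_card // => -[s d] [s' d'].
rewrite !inE /f /= => /andP[/eqP d0 /eqP d1] /andP[/eqP d0' /eqP d1'] eqf.
have eqs : s = s'.
  apply/colP; apply: ord2_ind.
    have := congr1 (fun m : V => red (m 0 0)) eqf.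
    by rewrite !mxE !redD !red_lift d0 d0' !addr0.
  have := congr1 (fun m : V => red (m 1 0)) eqf.
  by rewrite !mxE !redD !red_lift d1 d1' !addr0.
by rewrite eqs in eqf *; rewrite (addrI _ eqf).
Qed.

(** Fix one solution with image [w], and let J be the quarter turn. Any other image is
    [a w + b J w], so orthogonality forces [b = 0] and [a = 1] or [-1] modulo [p]. The images are
    thus [w] and [- w], each reached by at most [|G| / p] rotations. *)
Lemma card_orthogonal u d : u != 0 -> torsion u -> d \notin div_p ->
  (p * #|[set g in SO2 N | dot d (g *m u) == 0%R]| <= 2 * #|SO2 N|)%N.
Proof.
move=> nz_u tu nd; set T := [set g in _ | _].
have [g0|T0] := pickP (mem T); last by rewrite eq_card0 ?muln0.
rewrite /= inE => /andP[g0G /eqP d0].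
have [w wE] : exists w, w = g0 *m u by exists (g0 *m u).
rewrite -wE in d0.
have tw : torsion w by rewrite wE; apply: torsion_mul.
have nz_w : w != 0.
  apply: contraNneq nz_u => gu0.
  by rewrite -[u]mul1mx -(SO2_trK g0G) -mulmxA -wE gu0 mulmx0.
(* Were [d] orthogonal to both [w] and its quarter turn, its norm would kill [w], and anisotropy
   would put [d] in [div_p]. *)
have nJ : dot d (rot_mx 0 1 *m w) != 0.
  apply: contra nd => /eqP; move: d0.
  rewrite !dotE rot_mul0 rot_mul1 => e1 e2.
  have : (d 0 0 ^+ 2 + d 1 0 ^+ 2) *: w = 0.
    apply: cV2_eq; rewrite !mxE.
      transitivity (d 0 0 * (d 0 0 * w 0 0 + d 1 0 * w 1 0)
        + d 1 0 * (d 0 0 * (0 * w 0 0 - 1 * w 1 0) + d 1 0 * (1 * w 0 0 + 0 * w 1 0)));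
        first by ring.
      by rewrite e1 e2; ring.
    transitivity (d 1 0 * (d 0 0 * w 0 0 + d 1 0 * w 1 0)
        - d 0 0 * (d 0 0 * (0 * w 0 0 - 1 * w 1 0) + d 1 0 * (1 * w 0 0 + 0 * w 1 0)));
        first by ring.
    by rewrite e1 e2; ring.
  move/(scale_eq0_red nz_w); rewrite redD !red_sqr => /aniso[E0 E1].
  by rewrite inE E0 E1 !eqxx.
have sub : T \subset [set g in SO2 N | g *m u == w] :|: [set g in SO2 N | g *m u == - w].
  apply/subsetP => g; rewrite inE => /andP[gG /eqP dg].
  rewrite in_setU [g \in _]inE [X in _ || X]inE gG /=.
  have := SO2_mul gG (etrans (SO2_tr g0) g0G) => /SO2P[a [b [gE ab]]].
  have gw : g *m u = rot_mx a b *m w.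
    by rewrite -gE wE -!mulmxA [g0^T *m _]mulmxA SO2_trK // mul1mx.
  rewrite gw in dg *.
  have b0 : red b = 0.
    apply/eqP; apply: contraT => /red_unit ub; case/eqP: nJ; apply: (mulrI ub).
    have : a * dot d w + b * dot d (rot_mx 0 1 *m w) = dot d (rot_mx a b *m w).
      by rewrite !dotE !rot_mul0 !rot_mul1; ring.
    by rewrite d0 dg !mulr0 add0r.
  have /eqP := congr1 red ab; rewrite redD !red_sqr b0 red1 expr0n addr0.
  rewrite sqrf_eq1 => /orP[] /eqP a1; apply/orP.
    left; rewrite (@rot_torsion_eq _ _ 1 0) ?red1 ?red0 //.
    by rewrite rot_mx10 mul1mx.
  right; rewrite (@rot_torsion_eq _ _ (-1) 0) ?redN ?red1 ?red0 //.
  by apply/eqP; apply: cV2_eq; rewrite ?rot_mul0 ?rot_mul1 !mxE; ring.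
rewrite (leq_trans (leq_mul (leqnn p) (subset_leq_card sub))) //.
rewrite (leq_trans (leq_mul (leqnn p) (leq_card_setU _ _))) //.
by rewrite mulnDr mul2n -addnn leq_add ?card_transporter.
Qed.

(** * Additive characters of the plane and bounds for the orbit mass *)

Variable zeta : algC.
Hypothesis zeta_prim : N.-primitive_root zeta.

Definition echar u v : algC := zeta ^+ (dot u v : nat).

Lemma zetaD x y : zeta ^+ (x + y : 'Z_N)%R = zeta ^+ x * zeta ^+ y.
Proof.
rewrite -exprD -(prim_expr_mod zeta_prim (x + y)) /=.
by congr (_ ^+ (_ %% _)); rewrite Zp_cast ?modulus_gt1.
Qed.

Lemma zeta_eq1 x : (zeta ^+ x == 1) = (x == 0).
Proof.
rewrite -(expr0 zeta) (eq_prim_root_expr zeta_prim) mod0n modn_small //.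
by rewrite (leq_trans (ltn_ord x)) // Zp_cast ?modulus_gt1.
Qed.

Lemma echarDl u v w : echar (u + v) w = echar u w * echar v w.
Proof. by rewrite /echar dotDl zetaD. Qed.

Lemma echarC u v : echar u v = echar v u.
Proof. by rewrite /echar dotC. Qed.

Lemma echar_norm u v : `|echar u v| = 1.
Proof.
rewrite normrX; suff -> : `|zeta| = 1 by rewrite expr1n.
have N_gt0 := ltnW modulus_gt1.
apply/eqP; rewrite -(pexpr_eq1 N_gt0) // -normrX (prim_expr_order zeta_prim).
by rewrite normr1.
Qed.

Lemma echar_eq1 u v : (echar u v == 1) = (dot u v == 0).
Proof. exact: zeta_eq1. Qed.

Lemma echar_nondeg u : u != 0 -> exists v, echar u v != 1.
Proof.
rewrite cV2_eq0 negb_and => /orP[] nz; [exists (\col_i (i == 0)%:R)|exists (\col_i (i == 1)%:R)].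
  by rewrite echar_eq1 dotE !mxE /= mulr1 mulr0 addr0.
by rewrite echar_eq1 dotE !mxE /= mulr1 mulr0 add0r.
Qed.

Lemma echarXr u v m : echar u (v *+ m) = echar u v ^+ m.
Proof.
elim: m => [|m IHm]; first by apply/eqP; rewrite mulr0n expr0 echar_eq1 dotE !mxE !mulr0 addr0.
by rewrite mulrS exprS (bicharDr echarDl echarC) IHm.
Qed.

Lemma echar_adj g u v : echar (g *m u) v = echar u (g^T *m v).
Proof. by rewrite /echar dot_adj. Qed.

Definition transform (A : {set V}) v : algC := \sum_(a in A) echar a v.

Definition orbit_mass (A : {set V}) v : algC :=
  \sum_(g in SO2 N) `|transform A (g *m v)| ^+ 2.

Lemma orbit_mass_ge0 A v : 0 <= orbit_mass A v.
Proof. by apply: sumr_ge0 => g _; rewrite exprn_ge0. Qed.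

(** Each orbit point is hit by at most [|G| / p] rotations, so the mass is controlled by the
    restriction estimate on the orbit. Squaring keeps [|A|^(3/2)] integral. *)
Lemma orbit_mass_torsion A u : u != 0 -> torsion u ->
  (p%:R * orbit_mass A u) ^+ 2 <= (9 * #|SO2 N| ^ 2 * #|A| ^ 3 * p ^ (2 * r))%:R.
Proof.
move=> nz_u tu; pose C := [set g *m u | g in SO2 N].
pose S := \sum_(w in C) `|transform A w| ^+ 2.
have S0 : 0 <= S by apply: sumr_ge0 => w _; rewrite exprn_ge0.
have leS : S ^+ 2 <= (3 * #|{: V}| * #|A| ^ 3)%:R.
  exact: (sidon_restriction echarDl echarC echar_norm echar_nondeg A (orbit_sidon nz_u tu)).
have leM : p%:R * orbit_mass A u <= #|SO2 N|%:R * S.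
  rewrite /orbit_mass (partition_big (fun g => g *m u) (mem C)) /=; last first.
    by move=> g gG; apply: imset_f.
  rewrite !mulr_sumr; apply: ler_sum => w wC.
  rewrite (eq_bigr (fun=> `|transform A w| ^+ 2)); last by move=> g /andP[_ /eqP ->].
  rewrite sumr_const -[X in _ * X]mulr_natl mulrA ler_wpM2r ?exprn_ge0 // -natrM ler_nat.
  rewrite (leq_trans _ (card_transporter w nz_u)) // leq_mul // subset_leq_card //.
  by apply/subsetP => g; rewrite unfold_in => gw; rewrite inE.
rewrite (@le_trans _ _ ((#|SO2 N|%:R * S) ^+ 2)) //.
  by rewrite lerXn2r ?nnegrE ?mulr_ge0 ?orbit_mass_ge0.
rewrite exprMn -natrX (le_trans (ler_wpM2l _ leS)) // -natrM ler_nat card_plane.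
(* The restriction constant 3 is absorbed in the 9 of the other case. *)
by set k := (p ^ _)%N; set k' := (_ ^ 3)%N; nia.
Qed.

(** If [p ^ k] is the least power of [p] killing [u], take [t = p ^ (k - 1)]: here [k >= 2], hence
    [2 (k - 1) >= k]. *)
Lemma torsion_level u : u != 0 -> ~~ torsion u ->
  exists t, [/\ t *: u != 0, (p%:R * t) *: u = 0 & t ^+ 2 *: u = 0].
Proof.
move=> nz_u ntu.
have exn : exists m, (p ^ m)%:R *: u == 0.
  by exists r; rewrite (_ : N%:R = 0 :> 'Z_N) ?scale0r //; apply: pchar_Zp; apply: modulus_gt1.
case: (ex_minnP exn) => -[|[|m]] /eqP m0 min_m.
- by rewrite scale1r in m0; rewrite m0 eqxx in nz_u.
- by rewrite /torsion -[p in p%:R]expn1 m0 eqxx in ntu.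
exists (p ^ m.+1)%:R; split.
- by apply/negP => /min_m; rewrite ltnn.
- by rewrite -natrM -expnS.
- have -> : ((p ^ m.+1)%:R ^+ 2 : 'Z_N) = (p ^ m)%:R * (p ^ m.+2)%:R.
    by rewrite -natrX -natrM -expnM -expnD; congr (_ ^ _)%:R; lia.
  by rewrite -scalerA m0 scaler0.
Qed.

(** First-order expansion: as [t ^+ 2] kills [u], both [1 - t ^+ 2] and the inverse of [1 + t ^+ 2]
    fix [u]. *)
Lemma cayley_small t u : t ^+ 2 *: u = 0 ->
  cayley t *m u = u + (2 * t) *: (rot_mx 0 1 *m u).
Proof.
move=> t2u.
have t2 i : t ^+ 2 * u i 0 = 0 by have := congr1 (fun m : V => m i 0) t2u; rewrite !mxE.
have inv i : u i 0 / (1 + t ^+ 2) = u i 0.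
  apply: (mulIr (cayley_den_unit t)); rewrite divrK ?cayley_den_unit //.
  by rewrite mulrDr mulr1 [X in _ + X]mulrC t2 addr0.
have t2' i : t ^+ 2 * (u i 0 / (1 + t ^+ 2)) = 0 by rewrite inv t2.
apply: cV2_eq; rewrite ?rot_mul0 ?rot_mul1 [RHS]mxE [(GRing.scale _ _ : V) _ _]mxE ?rot_mul0 ?rot_mul1.
  transitivity (u 0 0 / (1 + t ^+ 2) - t ^+ 2 * (u 0 0 / (1 + t ^+ 2))
     - 2 * t * (u 1 0 / (1 + t ^+ 2))); first by ring.
  by rewrite t2' !inv; ring.
transitivity (2 * t * (u 0 0 / (1 + t ^+ 2)) + u 1 0 / (1 + t ^+ 2)
     - t ^+ 2 * (u 1 0 / (1 + t ^+ 2))); first by ring.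
by rewrite t2' !inv; ring.
Qed.

(* Right translation by the element k = cayley t, which shifts u by the
   torsion vector w, multiplies the summand by the p-th root of unity
   [echar d (g *m w)]; only the g for which this root is 1 survive. *)
Lemma orbit_sum_le u d : u != 0 -> ~~ torsion u -> d \notin div_p ->
  p%:R * `|\sum_(g in SO2 N) echar d (g *m u)| <= (2 * #|SO2 N|)%:R.
Proof.
move=> nz_u ntu nd; have [t [nz_tu ptu t2u]] := torsion_level nz_u ntu.
pose k := cayley t; pose w := (2 * t) *: (rot_mx 0 1 *m u).
have kG : k \in SO2 N := cayley_SO2 t.
have JG : rot_mx 0 1 \in SO2 N by apply/SO2P; exists 0, 1; split=> //; ring.
have ku : k *m u = u + w := cayley_small t2u.
(* [t *: w] is a multiple of the quarter turn of [t ^+ 2 *: u], so it is 0; since [k] fixes [w],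
   iterating it shifts [u] by multiples of [w]. *)
have kw : k *m w = w.
  have tw : t *: w = 0.
    by rewrite /w scalerA mulrCA -expr2 -scalerA scalemxAr t2u mulmx0 scaler0.
  rewrite cayley_small; last by rewrite expr2 -scalerA tw scaler0.
  by rewrite -scalerA scalemxAr tw mulmx0 scaler0 addr0.
have tors_w : torsion w.
  rewrite /torsion /w scalerA mulrCA -scalerA scalemxAr.
  by rewrite ptu mulmx0 scaler0.
have nz_w : w != 0.
  apply: contraNneq nz_tu => w0; apply: contraT => nz_tu.
  have : 2 *: (t *: u) = 0.
    rewrite scalerA -[u]mul1mx -(SO2_trK JG) -mulmxA scalemxAr -/w w0 mulmx0 //.
  by move/(scale_eq0_red nz_tu)/eqP; rewrite red_two (negPf two_neq0).
pose X := \sum_(g in SO2 N) echar d (g *m u).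
have shift m : X = \sum_(g in SO2 N) echar d (g *m u) * echar d (g *m w) ^+ m.
  elim: m => [|m IHm]; first by apply: eq_bigr => g _; rewrite expr0 mulr1.
  rewrite {}IHm -(sum_SO2_mulr _ kG); apply: eq_bigr => g _.
  by rewrite -!mulmxA kw ku mulmxDr (bicharDr echarDl echarC) exprS mulrA.
have geom g : \sum_(m < p) echar d (g *m w) ^+ m =
    if dot d (g *m w) == 0 then p%:R else 0.
  rewrite -echar_eq1; have [->|nq] := eqVneq.
    by under eq_bigr do rewrite expr1n; rewrite sumr_const card_ord.
  have: echar d (g *m w) - 1 != 0 by rewrite subr_eq0.
  move/mulfI; apply; rewrite mulr0 -subrX1 -echarXr -scaler_nat scalemxAr.
  rewrite (eqP tors_w) mulmx0; apply/eqP.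
  by rewrite subr_eq0 echar_eq1 dotE !mxE !mulr0 addr0.
have leX : p%:R * `|X| <= p%:R * #|[set g in SO2 N | dot d (g *m w) == 0]|%:R.
  have -> : p%:R * `|X| = `|\sum_(m < p) X|.
    by rewrite sumr_const card_ord -[X *+ p]mulr_natl normrM normr_nat.
  rewrite (eq_bigr _ (fun (m : 'I_p) _ => shift m)).
  rewrite exchange_big /= (le_trans (ler_norm_sum _ _ _)) //.
  under eq_bigr do rewrite -mulr_sumr geom normrM echar_norm mul1r.
  rewrite (eq_bigr (fun g => if dot d (g *m w) == 0 then p%:R else 0)); last first.
    by move=> g _; case: ifP; rewrite ?normr0 ?normr_nat.
  rewrite -big_mkcondr /= sumr_const mulr_natr.
  rewrite (@eq_card _ _ (mem [set g in SO2 N | dot d (g *m w) == 0])) //.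
  by move=> g; rewrite [RHS]inE.
by rewrite (le_trans leX) // -natrM ler_nat card_orthogonal.
Qed.

(** For each [a], at most [m] of the [a'] lie in its class modulo [p] and get the trivial bound
    [|G|]; the others get [2 |G| / p]. *)
Lemma orbit_mass_nontorsion A u : u != 0 -> ~~ torsion u ->
  (p%:R * orbit_mass A u) ^+ 2 <= (9 * #|SO2 N| ^ 2 * #|A| ^ 3 * p ^ (2 * r))%:R.
Proof.
move=> nz_u ntu; pose X d := \sum_(g in SO2 N) echar d (g *m u).
have massE : orbit_mass A u = \sum_(a in A) \sum_(a' in A) X (a - a').
  rewrite /orbit_mass; under eq_bigr do rewrite normCK rmorph_sum mulr_suml.
  rewrite exchange_big /=; apply: eq_bigr => a _.
  under eq_bigr do rewrite mulr_sumr.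
  rewrite exchange_big /=; apply: eq_bigr => a' _; apply: eq_bigr => g _.
  by rewrite echarDl (bicharNl echarDl echar_norm).
(* Both bounds are needed once squared: [m ^ 2 <= |A| * |div_p|]. *)
pose m := minn #|A| #|div_p|.
have leX d : p%:R * `|X d| <= (if d \in div_p then p * #|SO2 N| else 2 * #|SO2 N|)%:R.
  case: ifPn => [_|nd]; last exact: orbit_sum_le.
  rewrite natrM ler_wpM2l // (le_trans (ler_norm_sum _ _ _)) //.
  by under eq_bigr do rewrite echar_norm; rewrite sumr_const.
have leM : p%:R * orbit_mass A u <= (#|SO2 N| * #|A| * (p * m + 2 * #|A|))%:R.
  rewrite -[orbit_mass A u]ger0_norm ?orbit_mass_ge0 // massE.
  apply: (@le_trans _ _ (\sum_(a in A) (#|SO2 N| * (p * m + 2 * #|A|))%:R)); last first.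
    by rewrite sumr_const -mulrnA ler_nat mulnAC.
  rewrite (le_trans (ler_wpM2l _ (ler_norm_sum _ _ _))) // mulr_sumr; apply: ler_sum => a _.
  rewrite (le_trans (ler_wpM2l _ (ler_norm_sum _ _ _))) // mulr_sumr.
  rewrite (le_trans (ler_sum _ (fun (a' : V) _ => leX (a - a')))) // -natr_sum ler_nat.
  rewrite (bigID (fun a' : V => a - a' \in div_p)) /= mulnDr leq_add //.
    rewrite (eq_bigr (fun=> (p * #|SO2 N|)%N)); last by move=> a' /andP[_ ->].
    rewrite sum_nat_const mulnC -mulnA mulnCA !leq_mul2l leq_min.
    do 2!(apply/orP; right); apply/andP; split.
      by apply: subset_leq_card; apply/subsetP => a'; rewrite unfold_in => /andP[].
    rewrite -(card_imset _ (inj_comp (addrI a) oppr_inj)) subset_leq_card //.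
    by apply/subsetP => _ /imsetP[a' + ->]; rewrite unfold_in => /andP[].
  rewrite (eq_bigr (fun=> (2 * #|SO2 N|)%N)); last by move=> a' /andP[_ /negPf ->].
  rewrite sum_nat_const mulnC -mulnA mulnCA !leq_mul2l.
  do 2!(apply/orP; right).
  by apply: subset_leq_card; apply/subsetP => a'; rewrite unfold_in => /andP[].
rewrite (@le_trans _ _ ((#|SO2 N| * #|A| * (p * m + 2 * #|A|))%:R ^+ 2)) //.
  by rewrite lerXn2r ?nnegrE ?mulr_ge0 ?orbit_mass_ge0.
rewrite -natrX ler_nat.
have leA : (#|A| <= p ^ (2 * r))%N by rewrite -card_plane max_card.
have le1 : ((p * m) ^ 2 <= #|A| * p ^ (2 * r))%N.
  rewrite expnMn -[(m ^ 2)%N]mulnn mulnCA.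
  by rewrite leq_mul ?geq_minl // (leq_trans _ card_div_p) // leq_mul // geq_minr.
have le2 : (#|A| ^ 2 <= #|A| * p ^ (2 * r))%N by rewrite -mulnn leq_mul2l leA orbT.
(* The constant 9 is the square of 1 + 2, as [p * m] and [|A|] have squares at most
   [|A| * p ^ (2 * r)]. *)
have le3 : ((p * m + 2 * #|A|) ^ 2 <= 9 * (#|A| * p ^ (2 * r)))%N.
  move: le1 le2; move: (p * m)%N #|A| (#|A| * _)%N => i j k; nia.
rewrite !expnMn (leq_trans (leq_mul (leqnn _) le3)) //.
by rewrite leq_eqVlt; apply/orP; left; apply/eqP; ring.
Qed.

Lemma orbit_mass_le A u : u != 0 ->
  (p%:R * orbit_mass A u) ^+ 2 <= (9 * #|SO2 N| ^ 2 * #|A| ^ 3 * p ^ (2 * r))%:R.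
Proof.
move=> nz_u; have [tu|ntu] := boolP (torsion u); first exact: orbit_mass_torsion.
exact: orbit_mass_nontorsion.
Qed.

(** * Energy of the representation counts *)

Variables A B : {set V}.

Definition rep_count g u : nat :=
  #|[set q : V * V in setX A B | g *m q.1 - q.2 == u]|.

Lemma sum_rep_count g (f : V -> algC) :
  \sum_u (rep_count g u)%:R * f u = \sum_(a in A) \sum_(b in B) f (g *m a - b).
Proof.
rewrite pair_big (partition_big (fun q : V * V => g *m q.1 - q.2) predT) //=.
apply: eq_bigr => u _; rewrite (eq_bigr (fun=> f u)); last by move=> q /andP[_ /eqP ->].
rewrite sumr_const mulr_natl; congr (_ *+ _); apply: eq_card => -[a b].
by rewrite inE in_setX.
Qed.

Lemma fourier_rep_count g u :
  fourier echar (fun v => (rep_count g v)%:R) u = transform A (g^T *m u) * (transform B u)^*.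
Proof.
rewrite /fourier sum_rep_count mulr_suml; apply: eq_bigr => a _.
rewrite rmorph_sum mulr_sumr; apply: eq_bigr => b _.
by rewrite echarDl (bicharNl echarDl echar_norm) echar_adj.
Qed.

Lemma sum_transform_sqr : \sum_u `|transform B u| ^+ 2 = (p ^ (2 * r) * #|B|)%:R.
Proof.
rewrite natrM -card_plane.
have -> : #|B|%:R = \sum_u `|(u \in B)%:R : algC| ^+ 2.
  rewrite -sum1_card natr_sum big_mkcond /=; apply: eq_bigr => u _.
  by case: (u \in B); rewrite ?normr1 ?normr0 ?expr1n ?expr0n.
rewrite -(plancherel echarDl echarC echar_norm echar_nondeg).
apply: eq_bigr => u _; congr (`|_| ^+ 2); rewrite /transform big_mkcond /=.
by apply: eq_bigr => v _; case: (v \in B); rewrite ?mul1r ?mul0r.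
Qed.

(** Plancherel for each [g], where the transform of [rep_count g] is a product with the rotation
    moved onto the frequency. *)
Lemma energy_spectral :
  (p ^ (2 * r) * \sum_(g in SO2 N) \sum_u rep_count g u ^ 2)%:R =
  \sum_u `|transform B u| ^+ 2 * orbit_mass A u.
Proof.
transitivity (\sum_(g in SO2 N) \sum_u `|transform B u| ^+ 2 * `|transform A (g^T *m u)| ^+ 2).
  rewrite natrM -card_plane natr_sum mulr_sumr; apply: eq_bigr => g _.
  under [RHS]eq_bigr do rewrite mulrC -exprMn -[`|transform B _|]norm_conjC -normrM -fourier_rep_count.
  rewrite (plancherel echarDl echarC echar_norm echar_nondeg) natr_sum; congr (_ * _).
  by apply: eq_bigr => u _; rewrite normr_nat natrX.
rewrite (sum_SO2_tr (fun g => \sum_u `|transform B u| ^+ 2 * `|transform A (g *m u)| ^+ 2)).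
by rewrite exchange_big; apply: eq_bigr => u _; rewrite mulr_sumr.
Qed.

Lemma transform0 (D : {set V}) : transform D 0 = #|D|%:R.
Proof.
rewrite /transform (eq_bigr (fun=> 1)) ?sumr_const // => a _.
by apply/eqP; rewrite echar_eq1 dotE !mxE !mulr0 addr0.
Qed.

(** The density hypothesis squared and cleared of denominators. *)
Hypothesis large : (4 * p ^ (6 * r) <= p ^ 2 * #|A| * #|B| ^ 2)%N.

(** After squaring, this is [orbit_mass_le] combined with [large] times [9 |G|^2 |A|^3]. *)
Lemma orbit_mass_density u : u != 0 ->
  (2 * p ^ (2 * r))%:R * orbit_mass A u <= (3 * #|SO2 N| * #|A| ^ 2 * #|B|)%:R.
Proof.
move=> nz_u; have M0 := orbit_mass_ge0 A u.
have p_gt0 : 0 < (p%:R : algC) by rewrite ltr0n prime_gt0.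
rewrite -(ler_pM2l p_gt0) -(@ler_pXn2r _ 2) ?nnegrE ?mulr_ge0 ?(ltW p_gt0) //.
rewrite mulrCA exprMn (le_trans (ler_wpM2l _ (orbit_mass_le A nz_u))) ?exprn_ge0 //.
rewrite -natrX -2!natrM -natrX ler_nat.
have -> : ((2 * p ^ (2 * r)) ^ 2 * (9 * #|SO2 N| ^ 2 * #|A| ^ 3 * p ^ (2 * r)) =
  9 * #|SO2 N| ^ 2 * #|A| ^ 3 * (4 * p ^ (6 * r)))%N.
  have -> : (6 * r = 2 * r + 2 * r + 2 * r)%N by lia.
  by rewrite !expnD; ring.
rewrite (leq_trans (leq_mul (leqnn _) large)) //.
by rewrite leq_eqVlt; apply/orP; left; apply/eqP; ring.
Qed.

(** The constant is 2 + 3: frequency 0 is the main term, and elsewhere the preceding bound is summed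
    against [|transform B|^2], of total mass [p ^ (2 * r) * |B|]. *)
Lemma energy_le : (2 * p ^ (2 * r) * \sum_(g in SO2 N) \sum_u rep_count g u ^ 2 <=
  5 * #|SO2 N| * (#|A| * #|B|) ^ 2)%N.
Proof.
have P_gt0 : (0 < p ^ (2 * r))%N by rewrite expn_gt0 prime_gt0.
rewrite -(leq_pmul2l P_gt0) -(ler_nat algC) mulnCA natrM energy_spectral.
rewrite (bigD1 0) //= mulrDr.
have -> : (p ^ (2 * r) * (5 * #|SO2 N| * (#|A| * #|B|) ^ 2) =
  2 * p ^ (2 * r) * (#|B| ^ 2 * (#|SO2 N| * #|A| ^ 2)) +
  3 * #|SO2 N| * #|A| ^ 2 * #|B| * (p ^ (2 * r) * #|B|))%N by ring.
rewrite natrD lerD //.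
  rewrite [leRHS]natrM ler_wpM2l // natrM transform0 normr_nat -natrX ler_wpM2l //.
  rewrite /orbit_mass (eq_bigr (fun=> (#|A| ^ 2)%:R)); last first.
    by move=> g _; rewrite mulmx0 transform0 normr_nat natrX.
  by rewrite sumr_const natrM mulr_natl.
rewrite [leRHS]natrM -sum_transform_sqr [X in _ <= _ * X](bigD1 0) //= mulrDr.
rewrite -[leLHS]add0r lerD ?mulr_ge0 ?exprn_ge0 // !mulr_sumr; apply: ler_sum => u nz_u.
rewrite mulrCA mulrC ler_wpM2r ?exprn_ge0 //; exact: orbit_mass_density.
Qed.

Lemma card_rot_diff_energy g :
  ((#|A| * #|B|) ^ 2 <= #|rot_diff g A B| * \sum_u rep_count g u ^ 2)%N.
Proof.
rewrite -(ler_nat algC).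
have supp u : u \notin rot_diff g A B -> rep_count g u = 0%N.
  move=> nu; apply: eq_card0 => -[a b]; rewrite inE in_setX /=.
  apply/negP => /andP[/andP[aA bB] /eqP gab]; case/negP: nu.
  by rewrite -gab; apply: imset2_f.
have totE : (#|A| * #|B|)%:R = \sum_(u in rot_diff g A B) (rep_count g u)%:R :> algC.
  transitivity (\sum_u (rep_count g u)%:R * (1 : algC)).
    by rewrite sum_rep_count !sumr_const -mulrnA mulnC.
  rewrite [RHS]big_mkcond /=; apply: eq_bigr => u _; rewrite mulr1.
  by case: ifPn => // /supp->.
rewrite natrX totE -[X in X ^+ 2]ger0_norm ?sumr_ge0 //.
rewrite (le_trans (sqr_norm_sum_le _ _)) // natrM ler_wpM2l // natr_sum.
rewrite [leRHS](bigID (mem (rot_diff g A B))) /= -[leLHS]addr0 lerD ?sumr_ge0 //.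
by apply: ler_sum => u _; rewrite normr_nat natrX.
Qed.

(** Markov: by Cauchy-Schwarz each bad [g] has [p ^ (2 * r)] times its energy at least
    [5 (|A| |B|)^2], while the mean over the group is at most half of this. *)
Lemma card_small_rot_diff :
  (2 * #|[set g in SO2 N | 5 * #|rot_diff g A B| < p ^ (2 * r)]| <= #|SO2 N|)%N.
Proof.
set bad := [set g in _ | _].
have AB_gt0 : (0 < (#|A| * #|B|) ^ 2)%N.
  rewrite expn_gt0 muln_gt0; apply/orP; left.
  have : (0 < p ^ 2 * #|A| * #|B| ^ 2)%N.
    by apply: leq_trans large; rewrite muln_gt0 expn_gt0 (prime_gt0 p_pr).
  by rewrite 2!muln_gt0 => /andP[/andP[_ ->]]; rewrite expn_gt0 orbF.
have le1 : (#|bad| * (5 * (#|A| * #|B|) ^ 2) <=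
    p ^ (2 * r) * \sum_(g in SO2 N) \sum_u rep_count g u ^ 2)%N.
  rewrite -sum_nat_const big_distrr /=.
  rewrite [X in (_ <= X)%N](bigID (mem bad)) /= -[X in (X <= _)%N]addn0 leq_add //.
  rewrite [X in (_ <= X)%N](eq_bigl (mem bad)) => [|g]; last first.
    by rewrite /= [g \in bad]inE; case: (g \in SO2 N).
  apply: leq_sum => g; rewrite inE => /andP[_ small].
  rewrite (leq_trans (leq_mul (leqnn 5) (card_rot_diff_energy g))) //.
  by rewrite mulnA leq_mul2r (ltnW small) orbT.
have := energy_le; move: le1 AB_gt0.
move: (\sum_(g in _) _)%N ((#|A| * #|B|) ^ 2)%N (p ^ (2 * r))%N #|bad| #|SO2 N| => E c P b G.
move=> le1 c_gt0 le2; rewrite -mulnA in le2.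
have c5_gt0 : (0 < 5 * c)%N by rewrite muln_gt0.
rewrite -(leq_pmul2r c5_gt0) -mulnA (leq_trans (leq_mul (leqnn 2) le1)) //.
by rewrite (leq_trans le2) // mulnA [(G * 5)%N]mulnC.
Qed.

End PrimePower.

Theorem theorem1p4 (R : realType) :
  exists c c' : R, [/\ 0 < c, 0 < c' &
    forall (p r : nat) (A B : {set 'cV['Z_(p ^ r)]_2}),
      prime p -> (p = 3 %[mod 4])%N -> (0 < r)%N ->
      2 * p%:R^-1 <= Num.sqrt (density R A) * density R B ->
      c' * #|SO2 (p ^ r)|%:R <=
        #|[set g in SO2 (p ^ r) |
             c * (p ^ (2 * r))%:R <= #|rot_diff g A B|%:R :> R]|%:R].
Proof.
(* Both constants come from [card_small_rot_diff]. *)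
exists 5^-1, 2^-1; split; rewrite ?invr_gt0 ?ltr0n //.
move=> p r A B p_pr p34 r_gt0 hyp.
have large : (4 * p ^ (6 * r) <= p ^ 2 * #|A| * #|B| ^ 2)%N.
  have p_gt0 : 0 < (p%:R : R) by rewrite ltr0n prime_gt0.
  have P_gt0 : 0 < ((p ^ (2 * r))%:R : R) by rewrite ltr0n expn_gt0 prime_gt0.
  have dA : 0 <= density R A by rewrite /density divr_ge0.
  have dB : 0 <= density R B by rewrite /density divr_ge0.
  have : (2 * p%:R^-1) ^+ 2 <= (Num.sqrt (density R A) * density R B) ^+ 2.
    by rewrite lerXn2r ?nnegrE ?mulr_ge0 ?sqrtr_ge0 ?invr_ge0.
  rewrite !exprMn sqr_sqrtr // /density !exprVn.
  rewrite -(ler_nat R) (_ : (6 * r = 2 * r * 3)%N); last by lia.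
  rewrite (expnM p (2 * r) 3); move: (p ^ (2 * r))%N P_gt0 => k.
  rewrite 3!natrM !natrX; move: (k%:R : R) => P P_gt0.
  have u_gt0 : 0 < p%:R ^+ 2 * P ^+ 3 by rewrite mulr_gt0 ?exprn_gt0.
  move=> /(ler_wpM2l (ltW u_gt0)).
  have -> : p%:R ^+ 2 * P ^+ 3 * (2 ^+ 2 / p%:R ^+ 2) = 4 * P ^+ 3.
    by field; rewrite gt_eqF.
  have -> // : p%:R ^+ 2 * P ^+ 3 * (#|A|%:R / P * (#|B|%:R ^+ 2 / P ^+ 2)) =
     p%:R ^+ 2 * #|A|%:R * #|B|%:R ^+ 2.
  by field; rewrite gt_eqF.
have N_gt0 : (0 < p ^ r)%N by rewrite expn_gt0 prime_gt0.
(* The characters live in [algC]; their consequence reaches [R] as an inequality between natural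
   numbers. *)
have [zeta zeta_prim] := C_prim_root_exists N_gt0.
have := card_small_rot_diff p_pr p34 r_gt0 zeta_prim large.
set bad := [set g in _ | _]; set good := [set g in _ | _] => le_bad.
have cardE : #|SO2 (p ^ r)| = (#|good| + #|bad|)%N.
  rewrite -(cardsID good); congr (_ + _)%N.
    by apply: eq_card => g; rewrite in_setI [g \in good]inE andbA andbb.
  apply: eq_card => g; rewrite in_setD [g \in good]inE [g \in bad]inE.
  case: (g \in SO2 _) => //=; rewrite !andbT -ltNge.
  by rewrite -(ltr_nat R) natrM ltr_pdivlMl ?ltr0n.
rewrite ler_pdivrMl ?ltr0n // -natrM ler_nat cardE.
rewrite cardE in le_bad; lia.
Qed.
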